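(* Let $n\geq 1$ and let $S$ be any distribution of compact support on $R^n$. For $t\in R$ put - $S^t:=H^t_*(S)$ and $S_t:=t^{n-1}\cdot S^t$; - $B:=\int_0^1 S_u\,du\in\mathcal{D}'_c(R^n)$; - $B^t:=H^t_*(B)$ and $B_t:=t^n\cdot B^t$. Then for all $t\in R$, $$B_t=\int_0^t S_v\,dv.$$
   Context: $\mathbf{E}$ is a cartesian closed category with finite limits, and $R$ is a commutative ring object in it. Synthetic differential calculus and the Integration Axiom hold for $R$: every $\psi:R\to R$ has a unique primitive vanishing at $0$. No order on $R$ is assumed, so $t$ ranges over all of $R$. $\mathcal{D}'_c(M)$ is the object of $R$-linear maps $R^M\to R$, with evaluation $\langle T,\psi\rangle$. A map $f:M\to N$ induces $f_*:\mathcal{D}'_c(M)\to\mathcal{D}'_c(N)$ by $\langle f_*T,\phi\rangle=\langle T,\phi\circ f\rangle$. $H^t:R^n\to R^n$ is the homothety $x\mapsto t\cdot x$. Scalar multiples are taken in the $R$-module $\mathcal{D}'_c(R^n)$. Integrals of maps $h:R\to\mathcal{D}'_c(R^n)$ are defined by $\langle\int_a^b h(u)\,du,\psi\rangle=\int_a^b\langle h(u),\psi\rangle\,du$, using the Integration Axiom in $R$. *)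

(* Defs.v *)
(* The cartesian closed category E with finite limits is
   modelled through its internal (type-theoretic) language: objects are
   Rocq types, R^M is the function type M -> R, generalized elements are
   terms.  MathComp's ring structures are NOT used because they carry a
   decidable equality, which is incompatible with the Kock-Lawvere axiom. *)
From Stdlib Require Import Ring_theory.
From Stdlib Require Vectors.Fin.

(* The integration operator [integ] is given as data: [integ psi] is the
   (unique) primitive of [psi] vanishing at 0. *)
Record SDGRing := {
  car :> Type;
  r0 : car;
  r1 : car;
  radd : car -> car -> car;
  rmul : car -> car -> car;
  rsub : car -> car -> car;
  ropp : car -> car;
  rring : ring_theory r0 r1 radd rmul rsub ropp (@eq car);
  (* Kock-Lawvere: every map D -> R, D = {d | d^2 = 0}, is uniquely affine *)
  kock_lawvere : forall f : {d : car | rmul d d = r0} -> car,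
    exists! ab : car * car,
      forall d : {d : car | rmul d d = r0},
        f d = radd (fst ab) (rmul (snd ab) (proj1_sig d));
  integ : (car -> car) -> car -> car;
  integ_zero : forall psi, integ psi r0 = r0;
  integ_prim : forall psi x d, rmul d d = r0 ->
    integ psi (radd x d) = radd (integ psi x) (rmul (psi x) d);
  integ_unique : forall (psi F : car -> car),
    F r0 = r0 ->
    (forall x d, rmul d d = r0 -> F (radd x d) = radd (F x) (rmul (psi x) d)) ->
    forall x, F x = integ psi x
}.

Arguments r0 {_}. Arguments r1 {_}. Arguments radd {_}. Arguments rmul {_}.
Arguments rsub {_}. Arguments ropp {_}. Arguments integ {_}.

Section Defs.
Variable R : SDGRing.

Definition Rn (n : nat) : Type := Fin.t n -> R.

Fixpoint rpow (t : R) (k : nat) : R :=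
  match k with
  | O => r1
  | S k' => rmul t (rpow t k')
  end.

Definition rint (psi : R -> R) (a b : R) : R := rsub (integ psi b) (integ psi a).

(* elements of R^(R^M) -> R ; D'_c(M) consists of the R-linear ones *)
Definition distr (M : Type) : Type := (M -> R) -> R.

Definition is_distr {M : Type} (T : distr M) : Prop :=
  (forall phi psi : M -> R, T (fun x => radd (phi x) (psi x)) = radd (T phi) (T psi))
  /\ (forall (c : R) (phi : M -> R), T (fun x => rmul c (phi x)) = rmul c (T phi)).

Definition push {M N : Type} (f : M -> N) (T : distr M) : distr N :=
  fun phi => T (fun x => phi (f x)).

Definition dscale {M : Type} (c : R) (T : distr M) : distr M :=
  fun phi => rmul c (T phi).

Definition homothety {n : nat} (t : R) : Rn n -> Rn n :=
  fun x i => rmul t (x i).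

Definition dint {M : Type} (h : R -> distr M) (a b : R) : distr M :=
  fun psi => rint (fun u => h u psi) a b.

Definition S_up {n : nat} (S : distr (Rn n)) (t : R) : distr (Rn n) :=
  push (homothety t) S.

Definition S_low {n : nat} (S : distr (Rn n)) (t : R) : distr (Rn n) :=
  dscale (rpow t (n - 1)) (S_up S t).

Definition Bdist {n : nat} (S : distr (Rn n)) : distr (Rn n) :=
  dint (S_low S) r0 r1.

Definition B_low {n : nat} (S : distr (Rn n)) (t : R) : distr (Rn n) :=
  dscale (rpow t n) (push (homothety t) (Bdist S)).

End Defs.

Arguments rpow {_}. Arguments rint {_}. Arguments is_distr {_ _}.
Arguments push {_ _ _}. Arguments dscale {_ _}. Arguments homothety {_ _}.
Arguments dint {_ _}. Arguments S_up {_ _}. Arguments S_low {_ _}.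
Arguments Bdist {_ _}. Arguments B_low {_ _}.

(* Main.v *)
Require Import Defs.
From Stdlib Require Import Ring_theory Ring FunctionalExtensionality.

(* Substituting v = t u turns int_0^t S_v dv into int_0^1 t S_(tu) du.  Since
   H^t_* S^u = S^(tu) and t^n u^(n-1) = t (tu)^(n-1), the integrand equals
   t^n H^t_* S_u, and pushing forward and scaling commute with the integral.
   The substitution rule itself follows from the uniqueness of primitives in
   the Integration Axiom. *)

Section Homothety.
Variable R : SDGRing.
Add Ring R_ring : (rring R).

Lemma integ_scalel (c : R) (psi : R -> R) (x : R) :
  integ (fun u => rmul c (psi u)) x = rmul c (integ psi x).
Proof.
  symmetry.
  apply (integ_unique R (fun u => rmul c (psi u)) (fun y => rmul c (integ psi y))).
  - rewrite integ_zero. ring.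
  - intros y d Hd. rewrite integ_prim by exact Hd. ring.
Qed.

Lemma integ_subst_scale (g : R -> R) (t x : R) :
  integ g (rmul t x) = rmul t (integ (fun u => g (rmul t u)) x).
Proof.
  rewrite <- integ_scalel.
  apply (integ_unique R (fun u => rmul t (g (rmul t u))) (fun y => integ g (rmul t y))).
  - replace (rmul t r0) with (@r0 R) by ring. apply integ_zero.
  - intros y d Hd.
    replace (rmul t (radd y d)) with (radd (rmul t y) (rmul t d)) by ring.
    assert (Htd : rmul (rmul t d) (rmul t d) = r0).
    { replace (rmul (rmul t d) (rmul t d)) with (rmul (rmul t t) (rmul d d)) by ring.
      rewrite Hd. ring. }
    rewrite integ_prim by exact Htd. ring.
Qed.

Lemma dscale_dint {M : Type} (c : R) (h : R -> distr R M) (a b : R) :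
  dscale c (dint h a b) = dint (fun u => dscale c (h u)) a b.
Proof.
  apply functional_extensionality; intro phi.
  unfold dscale, dint, rint. rewrite !integ_scalel. ring.
Qed.

Lemma push_dint {M N : Type} (f : M -> N) (h : R -> distr R M) (a b : R) :
  push f (dint h a b) = dint (fun u => push f (h u)) a b.
Proof. reflexivity. Qed.

Lemma dint_subst_scale {M : Type} (h : R -> distr R M) (t : R) :
  dint (fun u => dscale t (h (rmul t u))) r0 r1 = dint h r0 t.
Proof.
  apply functional_extensionality; intro phi.
  unfold dint, rint, dscale.
  rewrite !integ_zero, integ_scalel, <- (integ_subst_scale (fun v => h v phi)).
  replace (rmul t r1) with t by ring. ring.
Qed.

Lemma rpow_mul (t u : R) (k : nat) : rpow (rmul t u) k = rmul (rpow t k) (rpow u k).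
Proof. induction k as [|k IH]; simpl; [|rewrite IH]; ring. Qed.

Lemma homothety_comp {n : nat} (t u : R) (x : Rn R n) :
  homothety t (homothety u x) = homothety (rmul t u) x.
Proof. apply functional_extensionality; intro i. unfold homothety. ring. Qed.

Lemma push_homothety_S_up {n : nat} (S : distr R (Rn R n)) (t u : R) :
  push (homothety t) (S_up S u) = S_up S (rmul t u).
Proof.
  apply functional_extensionality; intro phi.
  unfold S_up, push. f_equal.
  apply functional_extensionality; intro x. rewrite homothety_comp. reflexivity.
Qed.

Lemma push_homothety_S_low {n : nat} (hn : 1 <= n) (S : distr R (Rn R n)) (t u : R) :
  dscale (rpow t n) (push (homothety t) (S_low S u)) = dscale t (S_low S (rmul t u)).
Proof.
  destruct n as [|m]; [inversion hn|].
  apply functional_extensionality; intro phi.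
  unfold S_low. rewrite <- push_homothety_S_up.
  unfold dscale, push. simpl. rewrite PeanoNat.Nat.sub_0_r, rpow_mul. ring.
Qed.

End Homothety.

Theorem mainTheorem6 (R : SDGRing) (n : nat) (hn : 1 <= n)
  (S : distr R (Rn R n)) (HS : is_distr S) :
  forall t : R, B_low S t = dint (S_low S) r0 t.
Proof.
  intro t. unfold B_low, Bdist.
  rewrite push_dint, dscale_dint, <- (dint_subst_scale R (S_low S) t).
  f_equal. apply functional_extensionality; intro u.
  apply push_homothety_S_low; exact hn.
Qed.
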